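(* There is an absolute constant $c>0$ such that for every integer $m\ge 2$ and every convex digital polygon $\Gamma$ contained in an $m\times m$ grid (i.e. $\Gamma\subset\{0,\dots,m\}^2$ up to translation) with $n_e(\Gamma)\ge 1$ edges, \[ \min_{l}\mathcal{L}^1(MS_l)\;\le\; c\,\log m\,\frac{\mathrm{Per}(\Gamma)}{n_e(\Gamma)}, \] where the minimum ranges over all maximal segments $MS_l$ of the contour of $\Gamma$.
   Context: A standard line with slope $a/b$ and shift $\mu$ ($a,b,\mu\in\mathbb{Z}$) is the set of $(x,y)\in\mathbb{Z}^2$ with $\mu\le ax-by<\mu+|a|+|b|$. A convex digital polygon (CDP) is a finite $\Gamma\subset\mathbb{Z}^2$ with $\Gamma=\mathrm{Conv}(\Gamma)\cap\mathbb{Z}^2$. Its vertices $V_1,\dots,V_e$ (cyclically ordered) form the minimal subset with $\Gamma=\mathrm{Conv}(V_1,\dots,V_e)\cap\mathbb{Z}^2$, and $n_e(\Gamma)=e$ is its number of vertices (equivalently of edges). Its boundary points form a closed 4-connected digital curve (the contour) passing through the vertices in cyclic order; the digital edge $[V_kV_{k+1}]$ is the portion of the contour from $V_k$ to $V_{k+1}$. A set of consecutive contour points is a digital straight segment (DSS) if it is contained in some standard line; a maximal segment is a DSS $P_i,\dots,P_j$ such that neither $P_{i-1},\dots,P_j$ nor $P_i,\dots,P_{j+1}$ is a DSS. $\mathcal{L}^1$ denotes city-block length (number of unit steps) of a set of consecutive contour points, and $\mathrm{Per}(\Gamma)$ is the sum of the $\mathcal{L}^1$-lengths of its digital edges. 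*)

(* Defs.v *)
From HB Require Import structures.
From mathcomp Require Import all_boot all_order all_algebra.
From mathcomp Require Import finmap.
From Stdlib Require Import Reals.
Set Implicit Arguments. Unset Strict Implicit. Unset Printing Implicit Defensive.
Import Order.TTheory GRing.Theory Num.Theory.
Local Open Scope fset_scope.
Local Open Scope ring_scope.

Definition pt := (int * int)%type.

Definition in_std_line (a b mu : int) (p : pt) : bool :=
  (mu <= a * p.1 - b * p.2) && (a * p.1 - b * p.2 < mu + `|a| + `|b|).

Definition in_some_std_line (s : seq pt) : Prop :=
  exists a b mu : int, all (in_std_line a b mu) s.

(** p lies in the (real, equivalently rational) convex hull of the finite set S. *)
Definition inConv (S : {fset pt}) (p : pt) : Prop :=
  exists w : pt -> rat,
    (forall q, q \in S -> 0 <= w q) /\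
    \sum_(q <- enum_fset S) w q = 1 /\
    \sum_(q <- enum_fset S) w q * (q.1)%:~R = (p.1)%:~R /\
    \sum_(q <- enum_fset S) w q * (q.2)%:~R = (p.2)%:~R.

Definition CDP (G : {fset pt}) : Prop := forall p, inConv G p -> p \in G.

Definition spans (G S : {fset pt}) : Prop := forall p, p \in G <-> inConv S p.

Definition vertex_set (G V : {fset pt}) : Prop :=
  V `<=` G /\ spans G V /\ (forall V', V' `<` V -> ~ spans G V').

Definition in_grid_up_to_translation (m : nat) (G : {fset pt}) : Prop :=
  exists t : pt, forall p, p \in G ->
    (0 <= p.1 + t.1 <= m%:Z) && (0 <= p.2 + t.2 <= m%:Z).

Definition unit_step (p q : pt) : bool := (absz (p.1 - q.1) + absz (p.2 - q.2) == 1)%N.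
Definition l1dist (p q : pt) : nat := (absz (p.1 - q.1) + absz (p.2 - q.2))%N.

Definition boundary (G : {fset pt}) (p : pt) : Prop :=
  p \in G /\ exists d1 d2 : int, `|d1| <= 1 /\ `|d2| <= 1 /\ (p.1 + d1, p.2 + d2) \notin G.

Local Close Scope ring_scope.

(** A closed contour is represented by a list P = [P_0; ...; P_N] with P_N = P_0
    (a closed walk with N = (size P).-1 unit steps).  [idx] lists the indices
    0 = i_1 < ... < i_e of the vertices V_1..V_e along the contour. *)
Definition nsteps (P : seq pt) : nat := (size P).-1.
Definition P0 : pt := (Posz 0, Posz 0).
Definition subwalk (P : seq pt) (s t : nat) : seq pt :=
  [seq nth P0 P j | j <- iota s (t - s).+1].

(** Digital edges as index pairs (i_k, i_{k+1}) , the last one being (i_e, N). *)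
Definition edges (P : seq pt) (idx : seq nat) : seq (nat * nat) :=
  zip idx (behead (rcons idx (nsteps P))).

Definition is_contour (G V : {fset pt}) (P : seq pt) (idx : seq nat) : Prop :=
  [/\ (0 < size P)%N /\ last P0 P = head P0 P,
      (forall j, (j < nsteps P)%N -> unit_step (nth P0 P j) (nth P0 P j.+1)),
      (forall q, q \in P <-> boundary G q),
      [/\ head 1%N idx = 0%N, sorted ltn idx, all (fun i => i <= nsteps P)%N idx,
          uniq [seq nth P0 P i | i <- idx] &
          (forall v, v \in V <-> v \in [seq nth P0 P i | i <- idx])] &
      (forall e, e \in edges P idx ->
         in_some_std_line (subwalk P e.1 e.2) /\
         (e.2 - e.1)%N = l1dist (nth P0 P e.1) (nth P0 P e.2))].

Definition per (P : seq pt) (idx : seq nat) : nat :=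
  (\sum_(e <- edges P idx) (e.2 - e.1))%N.

Definition cpt (P : seq pt) (j : nat) : pt := nth P0 P (j %% maxn (nsteps P) 1).

(** The run of consecutive contour points P_i, ..., P_{i+k} (k unit steps,
    i.e. L^1-length k). *)
Definition run (P : seq pt) (i k : nat) : seq pt := [seq cpt P (i + j) | j <- iota 0 k.+1].

Definition is_DSS (P : seq pt) (i k : nat) : Prop := in_some_std_line (run P i k).

(** Maximal segment starting at i with k steps; runs never exceed one full
    turn of the contour (at most N points). *)
Definition maximal_segment (P : seq pt) (i k : nat) : Prop :=
  let M := maxn (nsteps P) 1 in
  [/\ (i < M)%N, (k <= (nsteps P).-1)%N, is_DSS P i k,
      ~ ((k.+1 <= (nsteps P).-1)%N /\ is_DSS P i k.+1) &
      ~ ((k.+1 <= (nsteps P).-1)%N /\ is_DSS P ((i + M).-1 %% M) k.+1)].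

(* Main.v *)
From Stdlib Require Import Reals Lra Classical.
From HB Require Import structures.
From mathcomp Require Import all_boot all_order all_algebra.
From mathcomp Require Import finmap zify ring.
Require Import Defs.
(** A digital straight segment contains only [O(log m)] vertices.  The points of a
    standard line are determined by their position [+-x +- y] along it, so if [u]
    and [w] are vertices on the segment and [2u - w] has a position covered by the
    segment and lies in the strip, then [2u - w] belongs to the polygon and [u] is
    the midpoint of two of its points, which is absurd.  Classifying the vertices by
    the nearer end of the segment, the dyadic scale of the distance to that end, and
    the half of the strip they lie in, two vertices of the same class would allow
    such a reflection.  Hence with [Q] the number of classes, a maximal segment
    through the middle one of [2Q + 1] consecutive vertices stays between the two
    extreme ones, and by averaging some such window of vertices has length
    [O(Q Per / n_e)]. *)

Set Implicit Arguments. Unset Strict Implicit. Unset Printing Implicit Defensive.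
Import Order.TTheory GRing.Theory Num.Theory.
Local Open Scope fset_scope.

(** * Convex combinations and vertices *)

Section Geometry.
Local Open Scope ring_scope.

Lemma inConv_sub (A B : {fset pt}) (p : pt) : A `<=` B -> inConv A p -> inConv B p.
Proof.
move=> sAB [w [w0 [w1 [wx wy]]]].
pose w' q := if q \in A then w q else 0.
have sumE (F : pt -> rat) :
  \sum_(q <- enum_fset B) w' q * F q = \sum_(q <- enum_fset A) w q * F q.
  rewrite (big_fsetID _ (mem A)) /= [X in _ + X]big1_fset ?addr0; last first.
    by move=> q; rewrite !inE /= => /andP[_ /negbTE nqA] _; rewrite /w' nqA mul0r.
  have -> : [fset x | x in B & x \in A] = A.
    by apply/fsetP => x; rewrite !inE /= andbC; case: (boolP (x \in A)) => //= /(fsubsetP sAB).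
  by apply: eq_big_seq => q qA; rewrite /w' qA.
exists w'; split; last split; [| |by rewrite !sumE].
- by move=> q _; rewrite /w'; case: ifP => // /w0.
- by rewrite -w1 -[RHS](eq_bigr _ (fun q _ => mulr1 (w q))) -sumE; apply: eq_bigr => q _; rewrite mulr1.
Qed.

(** Solving the representation of [v] for [v] itself divides the other weights by [1 - W v];
    substituting the result for [v] in a combination giving [p] eliminates [v]. *)
Lemma inConv_remove (V : {fset pt}) (v p : pt) (W : pt -> rat) :
  v \in V -> (forall q, q \in V -> 0 <= W q) ->
  \sum_(q <- enum_fset V) W q = 1 ->
  \sum_(q <- enum_fset V) W q * (q.1)%:~R = (v.1)%:~R ->
  \sum_(q <- enum_fset V) W q * (q.2)%:~R = (v.2)%:~R ->
  W v != 1 -> inConv V p -> inConv (V `\ v) p.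
Proof.
move=> vV W0 W1 Wx Wy Wv [w [w0 [w1 [wx wy]]]].
have W0' q : q \in V `\ v -> 0 <= W q by rewrite !inE => /andP[_ /W0].
have Wv1 : 0 < 1 - W v.
  rewrite subr_gt0 lt_neqAle Wv -W1 (big_fsetD1 v) //= lerDl.
  by rewrite big_seq sumr_ge0.
have nz := lt0r_neq0 Wv1.
exists (fun q => w q + w v * (W q / (1 - W v))).
have sumE (F : pt -> rat) (x : rat) :
  \sum_(q <- enum_fset V) W q * F q = F v ->
  \sum_(q <- enum_fset V) w q * F q = x ->
  \sum_(q <- enum_fset (V `\ v)) (w q + w v * (W q / (1 - W v))) * F q = x.
  rewrite (big_fsetD1 v) //= => e1 <-.
  rewrite [RHS](big_fsetD1 v) //= addrC.
  under eq_bigr => q _ do rewrite mulrDl.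
  rewrite big_split /= ; congr (_ + _).
  have e2 : \sum_(i <- V `\ v) W i * F i = (1 - W v) * F v.
    by rewrite mulrBl mul1r -[X in X - _]e1; ring.
  transitivity ((\sum_(i <- V `\ v) W i * F i) * (w v / (1 - W v))).
    rewrite big_distrl /=; apply: eq_bigr => q _.
    by field.
  by rewrite e2; field.
split; last split; last split.
- move=> q qV; apply: addr_ge0; first by apply: w0; move: qV; rewrite !inE => /andP[].
  by apply: mulr_ge0; [exact: w0 | apply: divr_ge0; [exact: W0' | exact: ltW]].
- rewrite -[RHS](sumE (fun=> 1) 1); first by apply: eq_bigr => q _; rewrite mulr1.
  + by rewrite -[RHS]W1; apply: eq_bigr => q _; rewrite mulr1.
  + by rewrite -[RHS]w1; apply: eq_bigr => q _; rewrite mulr1.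
- exact: (sumE (fun q => q.1%:~R)).
- exact: (sumE (fun q => q.2%:~R)).
Qed.

Lemma vertex_not_midpoint (G V : {fset pt}) (v u q : pt) :
  vertex_set G V -> v \in V -> u \in G -> q \in G ->
  u.1 + q.1 = 2 * v.1 -> u.2 + q.2 = 2 * v.2 -> u = v.
Proof.
move=> [sVG [spV minV]] vV uG qG ex ey.
have [w [w0 [w1 [wx wy]]]] := (spV u).1 uG.
have [z [z0 [z1 [zx zy]]]] := (spV q).1 qG.
pose W p := (w p + z p) / 2%:R.
have sumW (F : pt -> rat) : \sum_(p <- enum_fset V) W p * F p =
   (\sum_(p <- enum_fset V) w p * F p + \sum_(p <- enum_fset V) z p * F p) / 2%:R.
  rewrite -big_split /= big_distrl /=; apply: eq_bigr => p _.
  by rewrite /W mulrAC mulrDl.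
have half (x y t : int) : x + y = 2 * t -> (x%:~R + y%:~R) / 2%:R = t%:~R :> rat.
  move=> e; rewrite -intrD e intrM mulrAC mulfV ?mul1r //.
have [Wv|Wv] := eqVneq (W v) 1; last first.
  case: (minV (V `\ v)); first by rewrite fproperD1.
  move=> p; split.
    move/(spV p).1; apply: (inConv_remove (W := W)) => //.
    - by move=> t tV; rewrite divr_ge0 ?addr_ge0 ?w0 ?z0.
    - rewrite -(eq_bigr _ (fun t _ => mulr1 (W t))) sumW.
      by rewrite !(eq_bigr _ (fun t _ => mulr1 (_ t))) w1 z1.
    - by rewrite sumW wx zx; apply: half.
    - by rewrite sumW wy zy; apply: half.
  by move/(inConv_sub (fsubD1set V v))/(spV p).2.
have le1 (y : pt -> rat) : (forall t, t \in V -> 0 <= y t) ->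
    \sum_(p <- enum_fset V) y p = 1 -> y v <= 1.
  move=> y0 <-; rewrite (big_fsetD1 v) //= lerDl big_seq sumr_ge0 // => i.
  by rewrite !inE => /andP[_ /y0].
have wv1 : w v = 1.
  apply/eqP; rewrite eq_le le1 //=; rewrite -(lerD2r (z v)).
  have -> : w v + z v = 1 + 1 by rewrite -[LHS](divfK (_ : 2%:R != 0)) // -/(W v) Wv mul1r.
  by rewrite lerD2l le1.
have w0' : forall p, p \in V `\ v -> w p = 0.
  have : \sum_(p <- enum_fset (V `\ v)) w p = 0.
    by apply: (addrI (w v)); rewrite addr0 {2}wv1 -w1 [RHS](big_fsetD1 v).
  move/eqP; rewrite big_seq psumr_eq0; last by move=> i; rewrite !inE => /andP[_ /w0].
  by move=> /allP h p pV; move: (h p pV); rewrite pV => /eqP.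
have wE (F : pt -> rat) : \sum_(p <- enum_fset V) w p * F p = F v.
  rewrite (big_fsetD1 v) //= wv1 mul1r big_seq big1 ?addr0 // => p /w0' ->.
  by rewrite mul0r.
move: wx wy; rewrite !wE => /intr_inj e1 /intr_inj e2.
by case: (u) (v) e1 e2 => [? ?] [? ?] /= -> ->.
Qed.

(** * Lattice points along a standard line *)

Definition line_pos (a b : int) (p : pt) : int :=
  (if 0 <= a then p.1 else - p.1) + (if 0 <= b then p.2 else - p.2).

(** Points of equal position differ by a multiple of a diagonal step along which [a * x - b * y]
    changes by exactly [|a| + |b|], the width of the half-open strip. The signs in [line_pos] are
    chosen for this. *)
Lemma line_pos_inj (a b mu : int) (p q : pt) :
  in_std_line a b mu p -> in_std_line a b mu q ->
  line_pos a b p = line_pos a b q -> p = q.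
Proof.
case: p q => [x y] [x' y']; rewrite /in_std_line /line_pos /= => hp hq e.
have -> : x = x' by move: e; case: (lerP 0 a) => ?; case: (lerP 0 b) => ? e; nia.
congr (_, _).
by move: e; case: (lerP 0 a) => ?; case: (lerP 0 b) => ? e; nia.
Qed.

Lemma unit_step_image_interval (f : nat -> int) (k : nat) :
  (forall j, (j < k)%N -> `|f j.+1 - f j| <= 1) ->
  exists (A : int) (K : nat), forall z,
    (exists2 j, (j <= k)%N & f j = z) <-> A <= z <= A + K%:Z.
Proof.
elim: k => [_|k IH h].
  exists (f 0%N), 0%N => z; split; first by move=> [[|j] // _ <-]; lia.
  by move=> hz; exists 0%N => //; lia.
have [j jk|A [K hA]] := IH; first by apply: h; lia.
have hk : A <= f k <= A + K%:Z by apply/hA; exists k.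
have hs := h k (ltnSn k).
have key (z : int) : (exists2 j, (j <= k.+1)%N & f j = z) <->
    (A <= z <= A + K%:Z) \/ z = f k.+1.
  split.
    move=> [j]; rewrite leq_eqVlt => /orP[/eqP -> <-|jk e]; first by right.
    by left; apply/hA; exists j.
  by move=> [/hA [j jk <-]|->]; [exists j => //; lia | exists k.+1].
have [lt|ge] := ltP (f k.+1) A.
  by exists (f k.+1), K.+1 => z; rewrite key; split; lia.
have [lt|ge'] := ltP (A + K%:Z) (f k.+1).
  by exists A, K.+1 => z; rewrite key; split; lia.
by exists A, K => z; rewrite key; split; lia.
Qed.

Lemma std_line_vertices_bound (G V : {fset pt}) (m k : nat) (a b mu : int)
    (f : nat -> pt) (s : seq pt) :
  in_grid_up_to_translation m G -> vertex_set G V ->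
  (forall j, (j <= k)%N -> f j \in G /\ in_std_line a b mu (f j)) ->
  (forall j, (j < k)%N -> unit_step (f j) (f j.+1)) ->
  uniq s -> (forall v, v \in s -> v \in V /\ exists2 j, (j <= k)%N & f j = v) ->
  (size s <= 4 * (trunc_log 2 (2 * m).+1).+1)%N.
Proof.
move=> [t grid] vs hf hstep us hs.
have [|A [K hA]] := @unit_step_image_interval (fun j => line_pos a b (f j)) k.
  move=> j /hstep; rewrite /unit_step /line_pos.
  by case: (lerP 0 a) => ?; case: (lerP 0 b) => ?; lia.
(* Each coordinate varies by at most [m] in the grid, so a signed sum of both varies by at most
   [2 * m]. *)
have Km : (K <= 2 * m)%N.
  have /hA [j0 /hf [/grid g0 _] e0] : A <= A <= A + K%:Z by lia.
  have /hA [j1 /hf [/grid g1 _] e1] : A <= A + K%:Z <= A + K%:Z by lia.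
  move: e0 e1 g0 g1; rewrite /line_pos.
  case: (f j0) (f j1) (t) => [x y] [x' y'] [t1 t2] /=.
  by case: (lerP 0 a) => ?; case: (lerP 0 b) => ?; lia.
pose L := trunc_log 2 (2 * m).+1.
pose pos p := absz (line_pos a b p - A).
pose low p := 2 * (a * p.1 - b * p.2 - mu) < `|a| + `|b|.
pose dist p := minn (pos p) (K - pos p).
(* Side, half of the strip, dyadic scale: injective on [s] because two vertices in
   the same class have both reflections inside the segment. *)
pose cl p := ((pos p * 2 <= K)%N, low p, inord (trunc_log 2 (dist p).+1) : 'I_L.+1).
have posP p : p \in s -> (pos p <= K)%N /\ line_pos a b p = A + (pos p)%:Z.
  move=> /hs [_ [j jk e]]; have : A <= line_pos a b p <= A + K%:Z.
    by apply/hA; exists j => //; rewrite e.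
  by rewrite /pos; lia.
have reflect_out u w : u \in s -> w \in s ->
    (pos w <= 2 * pos u)%N -> (2 * pos u <= K + pos w)%N ->
    in_std_line a b mu (2 * u.1 - w.1, 2 * u.2 - w.2) -> u = w.
  move=> us' ws h1 h2 hr.
  have [[_ pu] [_ pw]] := (posP u us', posP w ws).
  have pr : line_pos a b (2 * u.1 - w.1, 2 * u.2 - w.2)
      = A + (2 * pos u)%:Z - (pos w)%:Z.
    move: pu pw; rewrite /line_pos /=.
    by case: (lerP 0 a) => ?; case: (lerP 0 b) => ?; lia.
  have /hA [j jk ej] : A <= A + (2 * pos u)%:Z - (pos w)%:Z <= A + K%:Z by lia.
  have [fG fl] := hf j jk.
  have fj : f j = (2 * u.1 - w.1, 2 * u.2 - w.2).
    by apply: line_pos_inj fl hr _; rewrite ej pr.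
  have [uV _] := hs u us'; have [_ [i ik ei]] := hs w ws.
  have [wG _] := hf i ik; rewrite ei in wG.
  by apply/esym; apply: (vertex_not_midpoint vs uV wG fG); rewrite fj /=; lia.
(* Equal scales give [(dist w).+1 < 2 * (dist u).+1], that is [dist w <= 2 * dist u], so the
   reflection of [w] through [u] does not pass the nearer end. Lying on the same side of the middle
   takes care of the other end. *)
have close u w : u \in s -> w \in s -> (pos u * 2 <= K)%N = (pos w * 2 <= K)%N ->
    trunc_log 2 (dist u).+1 = trunc_log 2 (dist w).+1 ->
    (pos w <= 2 * pos u)%N /\ (2 * pos u <= K + pos w)%N.
  move=> us' ws side elog.
  have [[ku _] [kw _]] := (posP u us', posP w ws).
  have /andP[lu _] := trunc_log_bounds (isT : 1 < 2)%N (isT : 0 < (dist u).+1)%N.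
  have /andP[_ gw] := trunc_log_bounds (isT : 1 < 2)%N (isT : 0 < (dist w).+1)%N.
  move: lu gw; rewrite elog expnS; move: (expn _ _) => E.
  by rewrite /dist; move: side; case: (leqP (pos u * 2) K); case: (leqP (pos w * 2) K) => //; lia.
have cl_inj : {in s &, injective cl}.
  move=> u w us' ws [eside elow /(congr1 val)].
  (* [inord] has a default value out of range, so the scale can be read back only once it is known
     to be below [L.+1]. *)
  have logL p : p \in s -> (trunc_log 2 (dist p).+1 < L.+1)%N.
    move=> /posP [kp _]; rewrite ltnS; apply: leq_trunc_log.
    by rewrite /dist; lia.
  rewrite /= !inordK ?logL // => elog.
  have [uw1 uw2] := close u w us' ws eside elog.
  have [wu1 wu2] := close w u ws us' (esym eside) (esym elog).
  have r1 := reflect_out u w us' ws uw1 uw2.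
  have r2 := reflect_out w u ws us' wu1 wu2.
  have [_ [i ik ei]] := hs u us'; have [_ [j jk ej]] := hs w ws.
  have [_] := hf i ik; have [_] := hf j jk; rewrite ei ej => lw lu.
  apply: NNPP => ne.
  have n1 : ~~ in_std_line a b mu (2 * u.1 - w.1, 2 * u.2 - w.2).
    by apply/negP => /r1.
  have n2 : ~~ in_std_line a b mu (2 * w.1 - u.1, 2 * w.2 - u.2).
    by apply/negP => /r2 /esym.
  (* Consider the offset [a * x - b * y - mu] across the strip. In the lower half, reflecting
     through the point of larger offset stays in the strip; in the upper half, reflecting through
     the point of smaller offset does. *)
  move: elow lu lw n1 n2; rewrite /low /in_std_line /=.
  rewrite !mulrBr ![a * (2 * _)]mulrCA ![b * (2 * _)]mulrCA.
  by clear; lia.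
(* Two sides, two halves of the strip and [L.+1] scales make [4 * L.+1] classes. *)
have := max_card (mem (map cl s)).
have /card_uniqP -> : uniq (map cl s) by rewrite map_inj_in_uniq.
by rewrite size_map !card_prod card_bool card_ord.
Qed.

End Geometry.

(** * Vertices and runs on the closed contour *)

Local Open Scope nat_scope.

Lemma sum_edges (N x : nat) (s : seq nat) :
  path ltn x s -> all (fun i => i <= N) (x :: s) ->
  \sum_(e <- zip (x :: s) (rcons s N)) (e.2 - e.1) = N - x.
Proof.
elim: s x => [|y s IH] x /=; first by rewrite big_cons big_nil addn0.
move=> /andP[xy ys] /and3P[xN yN sN].
by rewrite big_cons IH //= ?yN //; lia.
Qed.

Lemma per_nsteps (G V : {fset pt}) (P : seq pt) (idx : seq nat) :
  is_contour G V P idx -> per P idx = nsteps P.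
Proof.
case=> _ _ _ [h0 hs hall _ _] _; rewrite /per /edges.
case: idx h0 hs hall => [|x s] //= -> hs hall.
by rewrite sum_edges // subn0.
Qed.

Lemma card_vertices (G V : {fset pt}) (P : seq pt) (idx : seq nat) :
  is_contour G V P idx -> #|` V| = size idx.
Proof.
case=> _ _ _ [_ _ _ us hV] _; rewrite -(size_map (nth P0 P)).
apply: perm_size; apply: uniq_perm => // v; apply/idP/idP => /hV //.
Qed.

(** The last position of [P] repeats the point at index 0, which [idx] already lists, so listing it
    again would contradict the distinctness of the vertices. *)
Lemma vertex_index_lt (G V : {fset pt}) (P : seq pt) (idx : seq nat) (i : nat) :
  is_contour G V P idx -> 0 < nsteps P -> i \in idx -> i < nsteps P.
Proof.
case=> [[Pn0 Plast] _ _ [h0 hs hall us _] _] N0 iidx.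
rewrite ltn_neqAle (allP hall) // andbT; apply/eqP => ei.
case: idx h0 hs hall us iidx => [|x s] //= -> hs _ /andP[/negP nin _].
rewrite inE => /orP[/eqP i0|ins]; first by lia.
apply: nin; apply/mapP; exists i => //.
by rewrite nth0 -Plast ei /nsteps nth_last.
Qed.

Lemma nsteps_mod (P : seq pt) (j : nat) : j %% maxn (nsteps P) 1 <= nsteps P.
Proof.
have := @ltn_pmod j (maxn (nsteps P) 1); rewrite leq_max orbT => /(_ isT).
lia.
Qed.

Lemma cpt_in (G V : {fset pt}) (P : seq pt) (idx : seq nat) (j : nat) :
  is_contour G V P idx -> cpt P j \in G.
Proof.
case=> [[Pn0 _] _ hb _ _].
have /hb [] // : cpt P j \in P.
by apply/mem_nth/(leq_ltn_trans (nsteps_mod P j)); rewrite /nsteps prednK.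
Qed.

Lemma cpt_unit_step (G V : {fset pt}) (P : seq pt) (idx : seq nat) (j : nat) :
  is_contour G V P idx -> 0 < nsteps P -> unit_step (cpt P j) (cpt P j.+1).
Proof.
case=> [[Pn0 Plast] hstep _ _ _] N0.
have eM : maxn (nsteps P) 1 = nsteps P by lia.
rewrite /cpt eM; have lt := ltn_pmod j N0.
have -> : nth P0 P (j.+1 %% nsteps P) = nth P0 P (j %% nsteps P).+1.
  rewrite -addn1 -modnDml addn1.
  (* At the wrap-around the walk reaches index [nsteps P], where it carries the same point as at
     index 0. *)
  have [e|ne] := eqVneq (j %% nsteps P).+1 (nsteps P).
    by rewrite e modnn nth0 -Plast -nth_last.
  by rewrite modn_small // ltn_neqAle ne.
exact: hstep.
Qed.

(** Transfers the vertex count to the contour. Indices are compared modulo [nsteps P] because a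
    segment may run past the starting point of the contour. *)
Lemma DSS_vertices_bound (G V : {fset pt}) (m : nat) (P : seq pt) (idx s : seq nat)
    (i k : nat) :
  in_grid_up_to_translation m G -> vertex_set G V -> is_contour G V P idx ->
  0 < nsteps P -> is_DSS P i k -> subseq s idx ->
  (forall t, t \in s -> exists2 j, j <= k & i + j = t %[mod nsteps P]) ->
  size s <= 4 * (trunc_log 2 (2 * m).+1).+1.
Proof.
move=> grid vs hP N0 [a [b [mu /allP hall]]] sub hs.
have eM : maxn (nsteps P) 1 = nsteps P by lia.
rewrite -(size_map (nth P0 P)).
apply: (@std_line_vertices_bound G V m k a b mu (fun j => cpt P (i + j))) => //.
- move=> j jk; split; first exact: cpt_in hP.
  by apply: hall; apply/mapP; exists j; rewrite // mem_iota.
- by move=> j _; rewrite addnS; exact: cpt_unit_step hP _.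
- have [_ _ _ [_ _ _ us _] _] := hP.
  exact: subseq_uniq (map_subseq _ sub) us.
- move=> v /mapP [t ts ->]; have tidx := mem_subseq sub ts; split.
    by have [_ _ _ [_ _ _ _ hV] _] := hP; apply/hV; exact: map_f.
  have [j jk ej] := hs t ts; exists j => //.
  by rewrite /cpt eM ej modn_small // (vertex_index_lt hP).
Qed.

(** * Maximal segments and averaging over windows of vertices *)

Lemma extend_to_maximal (P : seq pt) (c i k x : nat) :
  i < maxn (nsteps P) 1 -> k <= (nsteps P).-1 -> is_DSS P i k ->
  x <= k -> i + x = c %[mod maxn (nsteps P) 1] ->
  exists i' k' x', [/\ maximal_segment P i' k', x' <= k' &
                       i' + x' = c %[mod maxn (nsteps P) 1]].
Proof.
(* Greedy extension, by induction on the room left for [k]. The offset [x] of the marked position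
   [c] grows by one whenever the start moves back. *)
move: {2}(nsteps P - k) (leqnn (nsteps P - k)) => n.
elim: n i k x => [|n IH] i k x hn iM kN dss xk e.
  exists i, k, x; split=> //; split=> //; case; lia.
set M := maxn (nsteps P) 1 in iM e *.
have M0 : 0 < M by rewrite /M; lia.
have [[k1 d1]|nr] := classic (k.+1 <= (nsteps P).-1 /\ is_DSS P i k.+1).
  by apply: (IH i k.+1 x) => //; lia.
have [[k1 d1]|nl] := classic (k.+1 <= (nsteps P).-1 /\ is_DSS P ((i + M).-1 %% M) k.+1).
  apply: (IH ((i + M).-1 %% M) k.+1 x.+1) => //; rewrite -/M; first by lia.
    by rewrite ltn_pmod.
  rewrite modnDml -e.
  have -> : (i + M).-1 + x.+1 = (i + x) + M by lia.
  by rewrite modnDr.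
by exists i, k, x; split=> //; split.
Qed.

Lemma short_window (s : seq nat) (N W : nat) :
  sorted ltn s -> all (fun t => t < N) s -> 0 < W -> 0 < size s %/ W ->
  exists2 q, q * W + W.-1 < size s &
    nth 0 s (q * W + W.-1) - nth 0 s (q * W) <= N %/ (size s %/ W).
Proof.
move=> ss /allP sN W0 B0; set B := size s %/ W in B0 *; set D := N %/ B.
have BW : B * W <= size s by rewrite leq_trunc_div.
have smono i j : i < j -> j < size s -> nth 0 s i < nth 0 s j.
  by move=> ij js; apply: (sorted_ltn_nth ltn_trans 0 ss) => //; rewrite inE; lia.
apply: NNPP => no.
have long q : q < B -> nth 0 s (q * W) + D < nth 0 s (q * W + W.-1).
  move=> qB; have qs : q * W + W.-1 < size s by nia.
  by rewrite ltnNge; apply/negP => le; apply: no; exists q => //; lia.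
have low q : q < B -> q * D.+1 <= nth 0 s (q * W).
  elim: q => [|q IH] // qB; have {}IH := IH (ltnW qB).
  have := long q (ltnW qB).
  have := @smono (q * W + W.-1) (q.+1 * W); rewrite mulSn.
  have -> : q * W + W.-1 < W + q * W by lia.
  have -> : W + q * W < size s by nia.
  by move=> /(_ isT isT); lia.
have l1 := low B.-1; have l2 := long B.-1.
have l3 : nth 0 s (B.-1 * W + W.-1) < N.
  apply/sN/mem_nth; apply: leq_trans BW.
  by rewrite -[X in _ <= X * _](prednK B0) mulSn; lia.
have l4 : N < B * D.+1 by rewrite mulnC ltn_ceil.
have : B * D.+1 = B.-1 * D.+1 + D.+1 by rewrite -{1}(prednK B0) mulSn addnC.
lia.
Qed.

Lemma short_maximal_segment (G V : {fset pt}) (m : nat) (P : seq pt) (idx : seq nat) :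
  in_grid_up_to_translation m G -> vertex_set G V -> is_contour G V P idx ->
  exists i k, maximal_segment P i k /\
    k * size idx <= 2 * (8 * (trunc_log 2 (2 * m).+1).+1).+1 * nsteps P.
Proof.
move=> grid vs hP; set L := trunc_log _ _; set Q := 4 * L.+1.
(* [Q] bounds the vertices on one segment; a window of [2 * Q + 1] vertices has [Q] on each side of
   its middle one. *)
have -> : (8 * L.+1).+1 = (2 * Q).+1 by rewrite /Q; lia.
set W := (2 * Q).+1; set N := nsteps P; set e := size idx.
have M0 : 0 < maxn N 1 by lia.
(* A single point lies on the vertical standard line with [a = 1] and [b = 0], which starts the
   greedy extension. *)
have dss0 c : is_DSS P c 0.
  exists 1%R, 0%R, (cpt P (c + 0)).1; rewrite /run /= /in_std_line; lia.
(* With fewer than [W] vertices any maximal segment will do, since its length is less than [N] or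
   zero. *)
have [B0|B0] := posnP (e %/ W).
  have [i [k [x [hmax _ _]]]] :=
    @extend_to_maximal P 0 0 0 0 M0 (leq0n _) (dss0 0) (leqnn _) erefl.
  exists i, k; split=> //.
  have [_ kN _ _ _] := hmax.
  have eW : e < W by rewrite ltnNge -divn_gt0 // B0.
  by rewrite -/N in kN; nia.
have [_ _ _ [h0 ss hall us hV] _] := hP.
have smono i1 j1 : i1 < j1 -> j1 < e -> nth 0 idx i1 < nth 0 idx j1.
  by move=> ij je; apply: (sorted_ltn_nth ltn_trans 0 ss) => //; rewrite inE -/e; lia.
have eW : W <= e by rewrite -divn_gt0.
have N0 : 0 < N.
  have e1 : 1 < e by rewrite /W /Q in eW; lia.
  have h := smono 0 1 isT e1.
  have /(allP hall) : nth 0 idx 1 \in idx by rewrite mem_nth.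
  by rewrite -/N; lia.
have idxN t : t \in idx -> t < N by exact: vertex_index_lt hP N0.
have [||//|q qs qlen] := @short_window idx N W ss => //; first exact/allP.
rewrite -/e in qs qlen.
have eM : maxn N 1 = N by lia.
have nin t : t < e -> nth 0 idx t \in idx by move=> te; exact: mem_nth.
set c := nth 0 idx (q * W + Q).
have cN : c < maxn N 1 by rewrite eM; apply/idxN/nin; lia.
have [i [k [x [hmax xk ex]]]] :=
  @extend_to_maximal P c c 0 0 cN (leq0n _) (dss0 c) (leqnn _) (congr1 (modn^~ _) (addn0 c)).
exists i, k; split=> //.
rewrite -/N eM in ex.
have [_ _ dss _ _] := hmax.
have mono i1 j1 : i1 <= j1 -> j1 < e -> nth 0 idx i1 <= nth 0 idx j1.
  by rewrite leq_eqVlt => /orP[/eqP -> //|ij] je; apply/ltnW/smono.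
(* No segment can carry [Q.+1] consecutive vertices. *)
have bound (A : nat) : A + Q < e ->
    (forall t, A <= t <= A + Q -> exists2 j, j <= k & i + j = nth 0 idx t %[mod N]) -> False.
  move=> AQ hA.
  have sz : size (take Q.+1 (drop A idx)) = Q.+1 by rewrite size_take size_drop -/e; case: ifP; lia.
  have := @DSS_vertices_bound G V m P idx (take Q.+1 (drop A idx)) i k grid vs hP N0 dss.
  rewrite sz (subseq_trans (take_subseq _ _) (drop_subseq _ _)) -/L -/Q => /(_ isT).
  rewrite ltnn => H; suff: false by []; apply: H => t /(nthP 0) [j]; rewrite sz => jQ <-.
  by rewrite nth_take // nth_drop; apply: hA; lia.
(* Reaching the last vertex of the window would put all [Q.+1] vertices from the middle one onwards
   on the segment; [left] is the mirror image. *)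
have right : k - x < nth 0 idx (q * W + 2 * Q) - c.
  rewrite ltnNge; apply/negP => h; apply: (@bound (q * W + Q)); first by lia.
  move=> t /andP[t1 t2].
  have c1 : c <= nth 0 idx t by apply: mono => //; lia.
  have c2 : nth 0 idx t <= nth 0 idx (q * W + 2 * Q) by apply: mono; lia.
  exists (x + (nth 0 idx t - c)); first by lia.
  by rewrite addnA -modnDml ex modnDml subnKC.
have left : x < c - nth 0 idx (q * W).
  rewrite ltnNge; apply/negP => h; apply: (@bound (q * W)); first by lia.
  move=> t /andP[t1 t2].
  have c1 : nth 0 idx t <= c by apply: mono => //; lia.
  have c2 : nth 0 idx (q * W) <= nth 0 idx t by apply: mono; lia.
  exists (x - (c - nth 0 idx t)); first by lia.
  (* Adding the same amount to both sides clears the truncated subtraction. *)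
  apply/eqP; rewrite -(eqn_modDr (c - nth 0 idx t)); apply/eqP.
  have -> : i + (x - (c - nth 0 idx t)) + (c - nth 0 idx t) = i + x by lia.
  by rewrite ex subnKC.
have kD : k <= N %/ (e %/ W).
  by apply: leq_trans qlen; rewrite /=; lia.
have h1 : k * (e %/ W) <= N by apply: leq_trans (leq_trunc_div N (e %/ W)); rewrite leq_mul2r kD orbT.
have h2 : e < (e %/ W).+1 * W by rewrite ltn_ceil.
(* Since [e %/ W] is at least 1, its successor is at most twice it; this is the source of the factor
   2 in the bound. *)
have h3 : e <= 2 * W * (e %/ W).
  by apply: ltnW; apply: leq_trans h2 _; rewrite mulnAC leq_mul2r; apply/orP; right; lia.
have h4 : k * e <= k * (2 * W * (e %/ W)) by rewrite leq_mul2l h3 orbT.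
apply: leq_trans h4 _.
by rewrite mulnCA leq_mul2l h1 orbT.
Qed.

(** * Passage to real logarithms *)

Lemma INR_leq (x y : nat) : x <= y -> Rle (INR x) (INR y).
Proof. by move=> xy; apply: le_INR; lia. Qed.

Lemma ln_expn_le (x y n k : nat) : 0 < x -> 0 < y -> x ^ n <= y ^ k ->
  Rle (Rmult (INR n) (ln (INR x))) (Rmult (INR k) (ln (INR y))).
Proof.
move=> x0 y0 /INR_leq.
have INR_expn z l : INR (z ^ l) = pow (INR z) l.
  by elim: l => [|l IH] //=; rewrite expnS mult_INR IH.
have [x0' y0'] : Rlt 0 (INR x) /\ Rlt 0 (INR y) by split; apply: lt_0_INR; lia.
rewrite !INR_expn -!ln_pow // => -[lt|->]; last exact: Rle_refl.
by left; apply: ln_increasing => //; exact: pow_lt.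
Qed.

Lemma trunc_log_le_ln (m : nat) : 2 <= m ->
  Rle (Rmult (INR (trunc_log 2 (2 * m).+1)) (ln 2)) (Rmult 3 (ln (INR m))).
Proof.
move=> m2.
have /andP[le _] := trunc_log_bounds (isT : 1 < 2) (isT : 0 < (2 * m).+1).
(* The exponent 3 suffices because [2 * m + 1 <= m ^ 3] as soon as [m] is at least 2. *)
have h : 2 ^ trunc_log 2 (2 * m).+1 <= m ^ 3.
  by apply: leq_trans le _; rewrite !expnS expn0; nia.
have := ln_expn_le (isT : 0 < 2) (ltnW m2) h.
by rewrite (INR_IZR_INZ 2) (INR_IZR_INZ 3).
Qed.

Theorem theorem4 :
  exists c : R, Rlt 0 c /\
  forall (m : nat) (G V : {fset pt}) (P : seq pt) (idx : seq nat),
    (2 <= m)%N -> CDP G -> in_grid_up_to_translation m G ->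
    vertex_set G V -> (1 <= #|` V|)%N -> is_contour G V P idx ->
    exists i k : nat, maximal_segment P i k /\
      Rle (INR k) (Rmult (Rmult c (ln (INR m))) (Rdiv (INR (per P idx)) (INR #|` V|))).
Proof.
have ln2 : Rlt 0 (ln 2) by rewrite -ln_1; apply: ln_increasing; lra.
(* With [t] the base-2 logarithm of [m], the bounds [L <= 3 * t] and [1 <= t] give
   [16 * L + 18 <= 48 * t + 18 * t = 66 * t]. *)
exists (Rdiv 66 (ln 2)); split; first by apply: Rdiv_lt_0_compat; lra.
move=> m G V P idx m2 _ grid vs V1 hP.
have [i [k [hmax hk]]] := short_maximal_segment grid vs hP.
exists i, k; split=> //.
rewrite (per_nsteps hP); rewrite (card_vertices hP) in V1 *.
have e0 : Rlt 0 (INR (size idx)) by apply: lt_0_INR; lia.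
have := INR_leq hk; set L := trunc_log 2 (2 * m).+1.
have -> : 2 * (8 * L.+1).+1 * nsteps P = (16 * L + 18) * nsteps P by lia.
rewrite !mult_INR plus_INR mult_INR.
rewrite (INR_IZR_INZ 16) (INR_IZR_INZ 18) /=.
set t := Rdiv (ln (INR m)) (ln 2).
have tE : Rmult t (ln 2) = ln (INR m).
  by rewrite /t /Rdiv Rmult_assoc Rinv_l ?Rmult_1_r //; lra.
have t1 : Rle 1 t.
  apply: (Rmult_le_reg_r (ln 2)) => //; rewrite tE.
  have := @ln_expn_le 2 m 1 1 isT (ltnW m2) m2.
  by rewrite (INR_IZR_INZ 2) /=; lra.
have Lt : Rle (INR L) (Rmult 3 t).
  apply: (Rmult_le_reg_r (ln 2)) => //.
  by rewrite Rmult_assoc tE; exact: trunc_log_le_ln.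
move=> hk'.
apply: (Rmult_le_reg_r (INR (size idx))) => //.
apply: Rle_trans hk' _.
have -> : Rmult (Rmult (Rmult (Rdiv 66 (ln 2)) (ln (INR m)))
    (Rdiv (INR (nsteps P)) (INR (size idx)))) (INR (size idx))
  = Rmult (Rmult 66 t) (INR (nsteps P)).
  rewrite /t /Rdiv !Rmult_assoc Rinv_l ?Rmult_1_r; last by lra.
  by rewrite -(Rmult_assoc (Rinv _)) (Rmult_comm (Rinv _)) !Rmult_assoc.
apply: Rmult_le_compat_r; first exact: pos_INR.
lra.
Qed.
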